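(* Let $\hbar\neq0$ and $\upsilon\neq0$ be real. The two-sided relative convolution with a kernel $k(x_1,y_1,x_2,y_2)$ on $\mathbb{R}^{4n}$ is the integrated representation $\widetilde{\Xi}_\hbar$ of the Heisenberg group $\mathbb{H}^{2n}$ preceded by $B$: $$\mathsf{D}(k)=\widetilde{\Xi}_\hbar(k\circ B).$$
   Context: Pulled actions of $\mathbb{H}^n$ on functions on $\mathbb{R}^{2n}$: $[\Lambda_\hbar(s,x,y)f](x',y')=e^{\pi i\hbar(2s+xy'-yx')}f(x'-x,y'-y)$ and $[R_\hbar(s,x,y)f](x',y')=e^{\pi i\hbar(-2s+xy'-yx')}f(x'+x,y'+y)$ (dot products). Two-sided relative convolution: $\mathsf{D}(k)=\int_{\mathbb{R}^{4n}}k(x_1,y_1,x_2,y_2)\,\Lambda_\hbar(0,x_1,y_1)R_\hbar(0,x_2,y_2)\,dx_1dy_1dx_2dy_2$ (a bounded operator on $L_2(\mathbb{R}^{2n})$ for $k\in L_1(\mathbb{R}^{4n})$; understood weakly, from $\mathcal S(\mathbb{R}^{2n})$ to $\mathcal S'(\mathbb{R}^{2n})$, for tempered distributions $k$). $\widetilde{\Xi}_\hbar(s,x_1,x_2,y_1,y_2)=\Lambda_\hbar(s,x_1,y_1)R_\hbar(0,\upsilon y_2,x_2/\upsilon)$ for $(s,x_1,x_2,y_1,y_2)\in\mathbb{H}^{2n}$, $x_1,x_2,y_1,y_2\in\mathbb{R}^n$, and its integrated form is $\widetilde{\Xi}_\hbar(m)=\int_{\mathbb{R}^{4n}}m(x_1,x_2,y_1,y_2)\,\widetilde{\Xi}_\hbar(0,x_1,x_2,y_1,y_2)\,dx_1dx_2dy_1dy_2$.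 $B:\mathbb{R}^{4n}\to\mathbb{R}^{4n}$ is $B(x_1,x_2,y_1,y_2)=(x_1,y_1,\upsilon y_2,x_2/\upsilon)$. *)

(* Defs.v *)
From HB Require Import structures.
From mathcomp Require Import all_boot all_order all_algebra.
From mathcomp Require Import complex.
From mathcomp Require Import all_classical all_reals all_analysis.

Set Implicit Arguments.
Unset Strict Implicit.
Unset Printing Implicit Defensive.

Import Order.TTheory GRing.Theory Num.Theory.
Import numFieldNormedType.Exports.

Local Open Scope classical_set_scope.
Local Open Scope ring_scope.
Local Open Scope complex_scope.

Definition measure_rV_display : measure_display. Proof. exact. Qed.

Section measurable_rV.
Context {R : realType}.
Variable m : nat.

(* The product (equivalently, Borel) sigma-algebra of R^m. *)
Let coors : 'I_m -> 'rV[R]_m -> measurableTypeR R := fun i v => v ord0 i.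

Let rV_set0 : g_sigma_preimage coors set0.
Proof. exact: sigma_algebra0. Qed.

Let rV_setC A : g_sigma_preimage coors A -> g_sigma_preimage coors (~` A).
Proof. exact: sigma_algebraC. Qed.

Let rV_bigcup (F : _^nat) : (forall i, g_sigma_preimage coors (F i)) ->
  g_sigma_preimage coors (\bigcup_i (F i)).
Proof. exact: sigma_algebra_bigcup. Qed.

HB.instance Definition _ := @isMeasurable.Build measure_rV_display
  'rV[R]_m (g_sigma_preimage coors) rV_set0 rV_setC rV_bigcup.

Lemma measurable_rV_coord (i : 'I_m) :
  measurable_fun [set: 'rV[R]_m] (fun v => v ord0 i : measurableTypeR R).
Proof.
move=> _ Y mY; rewrite setTI; apply: sub_sigma_algebra => /=.
rewrite -bigcup_seq/=; exists i => /=; first by rewrite mem_index_enum.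
by exists Y => //; rewrite setTI.
Qed.

Lemma measurable_fun_rVP d (T : measurableType d) (f : T -> 'rV[R]_m) :
  (forall i, measurable_fun [set: T] (fun t => f t ord0 i : measurableTypeR R)) ->
  measurable_fun [set: T] f.
Proof.
move=> mf.
have sub : g_sigma_preimage (fun i => coors i \o f) `<=` measurable.
  apply: smallest_sub; first exact: sigma_algebra_measurable.
  rewrite -bigcup_seq => A [i _ [B mB <-]]; exact: mf.
move=> _ A mA; apply: sub; rewrite g_sigma_preimage_comp.
by exists A.
Qed.

End measurable_rV.

Section lebesgue_rV.
Context {R : realType}.

Definition rV_cons m (p : measurableTypeR R * 'rV[R]_m) : 'rV[R]_m.+1 :=
  \row_i (if unlift ord0 i is Some j then p.2 ord0 j else p.1).

Definition rV_uncons m (v : 'rV[R]_m.+1) : measurableTypeR R * 'rV[R]_m :=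
  (v ord0 ord0, \row_j v ord0 (lift ord0 j)).

Lemma rV_cons0 m p : @rV_cons m p ord0 ord0 = p.1.
Proof. by rewrite mxE unlift_none. Qed.

Lemma rV_consS m p i : @rV_cons m p ord0 (lift ord0 i) = p.2 ord0 i.
Proof. by rewrite mxE liftK. Qed.

Lemma rV_consK m : cancel (@rV_cons m) (@rV_uncons m).
Proof.
case=> a v; rewrite /rV_uncons rV_cons0; congr (_, _).
by apply/rowP => i; rewrite mxE rV_consS.
Qed.

Lemma measurable_rV_cons m : measurable_fun setT (@rV_cons m).
Proof.
apply: measurable_fun_rVP => i; case: (unliftP ord0 i) => [j|] ->.
  rewrite (_ : (fun _ => _) = (fun v : 'rV[R]_m => v ord0 j) \o snd).
    apply: (measurableT_comp (measurable_rV_coord j)).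
    exact: measurable_snd.
  by apply/funext => p; rewrite rV_consS.
rewrite (_ : (fun _ => _) = fst); first exact: measurable_fst.
by apply/funext => p; rewrite rV_cons0.
Qed.

Lemma measurable_rV_uncons m : measurable_fun setT (@rV_uncons m).
Proof.
apply: measurable_fun_pair; first exact: measurable_rV_coord.
apply: measurable_fun_rVP => i.
rewrite (_ : (fun _ => _) = (fun v : 'rV[R]_m.+1 => v ord0 (lift ord0 i))).
  exact: measurable_rV_coord.
by apply/funext => v; rewrite mxE.
Qed.

Section step.
Variables (m : nat) (mu : {sigma_finite_measure set 'rV[R]_m -> \bar R}).

Definition lebesgue_rV_step : set 'rV[R]_m.+1 -> \bar R :=
  pushforward (lebesgue_measure \x mu)%E (@rV_cons m).

Let mcons := @measurable_rV_cons m.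

Let step0 : lebesgue_rV_step set0 = 0%E.
Proof. by rewrite /lebesgue_rV_step /pushforward preimage_set0 measure0. Qed.

Let step_ge0 A : (0 <= lebesgue_rV_step A)%E.
Proof. exact: measure_ge0. Qed.

Let step_sigma_additive : semi_sigma_additive lebesgue_rV_step.
Proof.
move=> F mF tF mUF; rewrite /lebesgue_rV_step /pushforward preimage_bigcup.
apply: measure_semi_sigma_additive.
- by move=> k; rewrite -[X in measurable X]setTI; exact: mcons.
- apply/trivIsetP => /= i j _ _ ij; rewrite -preimage_setI.
  by move/trivIsetP : tF => /(_ _ _ _ _ ij) ->//; rewrite preimage_set0.
- by rewrite -preimage_bigcup -[X in measurable X]setTI; exact: mcons.
Qed.

HB.instance Definition _ := isMeasure.Build _ _ _ lebesgue_rV_step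
  step0 step_ge0 step_sigma_additive.

Let sigma_finite_step : sigma_finite setT lebesgue_rV_step.
Proof.
have /sigma_finiteP[F [FT ndF Foo]] := sigma_finiteT (@lebesgue_measure R).
have /sigma_finiteP[G [GT ndG Goo]] := sigma_finiteT mu.
exists (fun k => @rV_uncons m @^-1` (F k `*` G k)).
  rewrite -preimage_bigcup (_ : \bigcup_k _ = setT) ?preimage_setT//.
  rewrite -setXTT FT GT; apply/seteqP; split=> -[x y] /=.
    by move=> [k _ []] ? ?; split; exists k.
  move=> [[i _ Fix] [j _ Gjy]]; exists (maxn i j) => //; split.
    by move: x Fix; exact/subsetPset/ndF/leq_maxl.
  by move: y Gjy; exact/subsetPset/ndG/leq_maxr.
move=> k; have [mF Fk] := Foo k; have [mG Gk] := Goo k; split.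
  rewrite -[X in measurable X]setTI; apply: measurable_rV_uncons => //.
  exact: measurableX.
rewrite /lebesgue_rV_step /pushforward -comp_preimage.
rewrite (_ : _ \o _ = id); last by apply/funext => p /=; rewrite rV_consK.
by rewrite preimage_id product_measure1E// lte_mul_pinfty// ge0_fin_numE.
Qed.

HB.instance Definition _ :=
  Measure_isSigmaFinite.Build _ _ _ lebesgue_rV_step sigma_finite_step.

End step.

(* Lebesgue measure on R^m, the m-fold product of lebesgue_measure. *)
Fixpoint lebesgue_rV m : {sigma_finite_measure set 'rV[R]_m -> \bar R} :=
  match m with
  | 0 => dirac (0 : 'rV[R]_0)
  | m'.+1 => lebesgue_rV_step (lebesgue_rV m')
  end.

Lemma lebesgue_rV_box m (A : 'I_m -> set (measurableTypeR R)) :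
  (forall i, measurable (A i)) ->
  lebesgue_rV m [set v | forall i, A i (v ord0 i)] =
  (\prod_(i < m) lebesgue_measure (A i))%E.
Proof.
elim: m A => [|m IH] A mA.
  rewrite big_ord0 /= diracE mem_set// => -[].
  by [].
rewrite big_ord_recl -IH; last by move=> i; exact: mA.
pose B := [set v : 'rV[R]_m | forall i, A (lift ord0 i) (v ord0 i)].
have mB : measurable B.
  rewrite (_ : B = \big[setI/setT]_(i < m)
      ((fun v : 'rV[R]_m => v ord0 i) @^-1` A (lift ord0 i))).
    apply: bigsetI_measurable => i _; rewrite -[X in measurable X]setTI.
    exact: measurable_rV_coord.
  rewrite -bigcap_seq; apply/seteqP; split=> v /= H i => [_|]; apply: H => //=.
  by rewrite mem_index_enum.
rewrite -[RHS](@product_measure1E _ _ _ _ _ lebesgue_measure (lebesgue_rV m))//.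
congr (product_measure1 _ _ _).
apply/seteqP; split=> -[a v] /=.
  move=> H; split; first by have := H ord0; rewrite rV_cons0.
  by move=> i; have := H (lift ord0 i); rewrite rV_consS.
move=> [Ha Hv] i; case: (unliftP ord0 i) => [j|] ->; first by rewrite rV_consS.
by rewrite rV_cons0.
Qed.

End lebesgue_rV.

Section complex_functions.
Context {R : realType}.
Variable m : nat.
Implicit Types (f g : 'rV[R]_m -> R[i]).

Definition cmod (z : R[i]) : R := ComplexField.Normc.normc z.

Definition expi (t : R) : R[i] := cos t +i* sin t.

Definition cmeasurable f : Prop :=
  measurable_fun setT (fun x => complex.Re (f x)) /\
  measurable_fun setT (fun x => complex.Im (f x)).

Definition inLp (p : nat) f : Prop :=
  cmeasurable f /\ (\int[lebesgue_rV m]_x (cmod (f x) ^+ p)%:E < +oo)%E.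

Definition cintegral f : R[i] :=
  (\int[lebesgue_rV m]_x complex.Re (f x)) +i*
  (\int[lebesgue_rV m]_x complex.Im (f x)).

(* The bilinear pairing by which a function is read as a distribution. *)
Definition pairing f g : R[i] := cintegral (fun x => f x * g x).

Definition partial (i : 'I_m) f : 'rV[R]_m -> R[i] := fun x =>
  ('D_(delta_mx ord0 i) (fun y => complex.Re (f y)) x) +i*
  ('D_(delta_mx ord0 i) (fun y => complex.Im (f y)) x).

(* A multi-index is the sequence of its coordinates, with repetitions:
   [:: i; i; j] stands for d_i d_i d_j, respectively for x_i x_i x_j. *)
Definition partials (b : seq 'I_m) f : 'rV[R]_m -> R[i] := foldr partial f b.

Definition monomial (a : seq 'I_m) (x : 'rV[R]_m) : R :=
  \prod_(i <- a) x ord0 i.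

Definition smooth f : Prop := forall (b : seq 'I_m) (x : 'rV[R]_m),
  differentiable (fun y => complex.Re (partials b f y)) x /\
  differentiable (fun y => complex.Im (partials b f y)) x.

Definition seminorm_set (a b : seq 'I_m) f : set R :=
  [set `|monomial a x| * cmod (partials b f x) | x in [set: 'rV[R]_m]].

Definition seminorm (a b : seq 'I_m) f : R := sup (seminorm_set a b f).

Definition schwartz f : Prop :=
  smooth f /\ forall a b, has_ubound (seminorm_set a b f).

(* Tempered distributions are represented by functionals defined on all
   functions R^m -> C; only their values on Schwartz functions matter. *)
Definition functional := ('rV[R]_m -> R[i]) -> R[i].

Definition tempered (u : functional) : Prop :=
  (forall (c : R[i]) f g, schwartz f -> schwartz g ->
     u (fun x => c * f x + g x) = c * u f + u g) /\
  (exists (C : R) (l : seq (seq 'I_m * seq 'I_m)), forall f, schwartz f ->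
     cmod (u f) <= C * \sum_(ab <- l) seminorm ab.1 ab.2 f).

(* u \o L for a linear automorphism L of R^m, that is z |-> z *m lin1_mx L:
   <u \o L, f> = |det L|^-1 <u, f \o L^-1>. *)
Definition dist_comp (u : functional) (L : 'rV[R]_m -> 'rV[R]_m) :
    functional :=
  fun f => (`|\det (lin1_mx L)|^-1)%:C * u (fun z => f (z *m invmx (lin1_mx L))).

End complex_functions.

Section integrated_operators.
Context {R : realType}.
Variables (m d : nat).
Variable T : 'rV[R]_m -> ('rV[R]_d -> R[i]) -> ('rV[R]_d -> R[i]).

(* The operator \int k(z) T(z) dz for an integrable k; its value on an L_2
   function is meaningful almost everywhere. *)
Definition integrated (k : 'rV[R]_m -> R[i]) (f : 'rV[R]_d -> R[i]) :
    'rV[R]_d -> R[i] :=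
  fun p => cintegral (fun z => k z * T z f p).

(* The same integral for a tempered distribution k, in the weak sense:
   f is sent to the distribution g |-> <k, z |-> <T(z) f, g> >. *)
Definition weakly_integrated (k : @functional R m) (f : 'rV[R]_d -> R[i]) :
    @functional R d :=
  fun g => k (fun z => pairing (T z f) g).

End integrated_operators.

Section heisenberg.
Context {R : realType}.
Variable n : nat.
Variable h : R.

Definition dot (u v : 'rV[R]_n) : R := \sum_(i < n) u ord0 i * v ord0 i.

(* Points (x', y') of R^2n are the vectors row_mx x' y'. *)
Definition Lambda (s : R) (x y : 'rV[R]_n) (f : 'rV[R]_(n + n) -> R[i]) :
    'rV[R]_(n + n) -> R[i] :=
  fun p => let x' := lsubmx p in let y' := rsubmx p in
    expi (pi * h * (2 * s + dot x y' - dot y x')) *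
    f (row_mx (x' - x) (y' - y)).

Definition Rho (s : R) (x y : 'rV[R]_n) (f : 'rV[R]_(n + n) -> R[i]) :
    'rV[R]_(n + n) -> R[i] :=
  fun p => let x' := lsubmx p in let y' := rsubmx p in
    expi (pi * h * (- 2 * s + dot x y' - dot y x')) *
    f (row_mx (x' + x) (y' + y)).

Definition Xi (v : R) (s : R) (x1 x2 y1 y2 : 'rV[R]_n)
    (f : 'rV[R]_(n + n) -> R[i]) : 'rV[R]_(n + n) -> R[i] :=
  Lambda s x1 y1 (Rho 0 (v *: y2) (v^-1 *: x2) f).

(* Points (a, b, c, d) of R^4n are the vectors
   row_mx (row_mx a b) (row_mx c d). *)
Definition blk1 (z : 'rV[R]_(n + n + (n + n))) : 'rV[R]_n := lsubmx (lsubmx z).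
Definition blk2 (z : 'rV[R]_(n + n + (n + n))) : 'rV[R]_n := rsubmx (lsubmx z).
Definition blk3 (z : 'rV[R]_(n + n + (n + n))) : 'rV[R]_n := lsubmx (rsubmx z).
Definition blk4 (z : 'rV[R]_(n + n + (n + n))) : 'rV[R]_n := rsubmx (rsubmx z).

(* z = (x1, y1, x2, y2) *)
Definition LambdaR (z : 'rV[R]_(n + n + (n + n)))
    (f : 'rV[R]_(n + n) -> R[i]) : 'rV[R]_(n + n) -> R[i] :=
  Lambda 0 (blk1 z) (blk2 z) (Rho 0 (blk3 z) (blk4 z) f).

(* z = (x1, x2, y1, y2) *)
Definition Xi0 (v : R) (z : 'rV[R]_(n + n + (n + n)))
    (f : 'rV[R]_(n + n) -> R[i]) : 'rV[R]_(n + n) -> R[i] :=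
  Xi v 0 (blk1 z) (blk2 z) (blk3 z) (blk4 z) f.

Definition Bmap (v : R) (z : 'rV[R]_(n + n + (n + n))) :
    'rV[R]_(n + n + (n + n)) :=
  let x1 := blk1 z in let x2 := blk2 z in
  let y1 := blk3 z in let y2 := blk4 z in
  row_mx (row_mx x1 y1) (row_mx (v *: y2) (v^-1 *: x2)).

(* For h != 0 and Schwartz f, g the functions z |-> <T(z) f, g> to which the
   weak integrals apply the kernel are Schwartz on R^4n. *)
Definition Dconv := integrated LambdaR.
Definition Dconv_weak := weakly_integrated LambdaR.
Definition Xi_int (v : R) := integrated (Xi0 v).
Definition Xi_int_weak (v : R) := weakly_integrated (Xi0 v).

End heisenberg.

(* Main.v *)
From HB Require Import structures.
Require Import Defs.
From mathcomp Require Import all_boot all_order all_algebra.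
From mathcomp Require Import perm ring complex.
From mathcomp Require Import all_classical all_reals all_analysis.
From mathcomp Require Import measurable_realfun.
Import Order.TTheory GRing.Theory Num.Theory.
Import numFieldNormedType.Exports.

Set Implicit Arguments.
Unset Strict Implicit.
Unset Printing Implicit Defensive.

Local Open Scope classical_set_scope.
Local Open Scope ring_scope.
Local Open Scope complex_scope.

(** [Bmap v] permutes the coordinates of R^4n and scales them by the weights
    1, 1, v, 1/v, whose product is 1.  A weighted permutation [L] of the
    coordinates with weights of product 1 maps boxes to boxes of the same
    volume, hence preserves Lebesgue measure, which turns the two integrals
    into each other.  It also maps each partial derivative and
    each monomial to a multiple of another one, so that every Schwartz seminorm
    of [f \o L] is bounded by a multiple of a single seminorm of [f], and
    composition with it preserves tempered distributions.  Since [Bmap v] has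
    order 3, its determinant is 1 and its inverse is its square. *)

(** * Scaling of one-dimensional Lebesgue measure, and measurable boxes *)

(** By uniqueness of Lebesgue measure: [|a|] times the pushforward under multiplication by [a] gives
    every interval []x, y]] its length. *)
Lemma lebesgue_measure_preimage_scale (R : realType) (a : R)
    (A : set (measurableTypeR R)) :
  a != 0 -> measurable A ->
  lebesgue_measure ( *%R a @^-1` A : set (measurableTypeR R)) =
  (`|a|^-1%:E * lebesgue_measure A)%E.
Proof.
move=> a0 mA.
pose phi : measurableTypeR R -> measurableTypeR R := *%R a.
have mphi : measurable_fun setT phi.
  exact: mulrl_measurable.
pose push := (pushforward lebesgue_measure phi
  : {measure set (measurableTypeR R) -> \bar R}).
pose mu := (mscale (NngNum (normr_ge0 a)) (push mphi)
  : {measure set (measurableTypeR R) -> \bar R}).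
suff -> : lebesgue_measure A = mu A.
  by rewrite /mu /= /mscale /= muleA -EFinM mulVf ?normr_eq0// mul1e.
apply: lebesgue_measure_unique => // _ [[x y]] _ <-.
rewrite /mu /= /mscale /= /pushforward.
have [a_lt0|a_gt0|/eqP] := ltgtP a 0; last by rewrite (negbTE a0).
(* A negative factor swaps the endpoints and moves the closed end to the left; the length is
   unaffected. *)
- have -> : (fun z => a * z) @^-1` `]x, y] = `[a^-1 * y, a^-1 * x[%classic.
    apply/seteqP; split=> z /=; rewrite !in_itv /= => /andP[H1 H2];
      apply/andP; split.
    + by rewrite ler_ndivrMl.
    + by rewrite ltr_ndivlMl.
    + by rewrite -ltr_ndivlMl.
    + by rewrite -ler_ndivrMl.
  rewrite !lebesgue_measure_itv /= !lte_fin ltr_nM2l ?invr_lt0//.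
  case: ifPn => _; last by rewrite mule0.
  rewrite -!EFinB -EFinM ltr0_norm//.
  by congr EFin; field.
- have -> : (fun z => a * z) @^-1` `]x, y] = `]a^-1 * x, a^-1 * y]%classic.
    apply/seteqP; split=> z /=; rewrite !in_itv /= => /andP[H1 H2];
      apply/andP; split.
    + by rewrite ltr_pdivrMl.
    + by rewrite ler_pdivlMl.
    + by rewrite -ltr_pdivrMl.
    + by rewrite -ler_pdivlMl.
  rewrite !lebesgue_measure_itv /= !lte_fin ltr_pM2l ?invr_gt0//.
  case: ifPn => _; last by rewrite mule0.
  rewrite -!EFinB -EFinM gtr0_norm//.
  by congr EFin; field.
Qed.

Lemma measurable_rV_box (R : realType) (m : nat)
    (A : 'I_m -> set (measurableTypeR R)) : (forall i, measurable (A i)) ->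
  measurable [set z : 'rV[R]_m | forall i, A i (z ord0 i)].
Proof.
move=> mA.
rewrite (_ : [set _ | _] = \big[setI/setT]_(i < m)
    ((fun z : 'rV[R]_m => z ord0 i) @^-1` A i)).
  apply: bigsetI_measurable => i _; rewrite -[X in measurable X]setTI.
  by apply: measurable_rV_coord => //; exact: mA.
rewrite -bigcap_seq; apply/seteqP; split=> z /= zA i => [_|]; apply: zA => //=.
by rewrite mem_index_enum.
Qed.

(** * Measurability of complex-valued functions *)

Section complex_measurable.
Variables (R : realType) (m : nat).
Implicit Types f g : 'rV[R]_m -> R[i].

Lemma measurable_cmod f :
  cmeasurable f -> measurable_fun setT (fun z => cmod (f z)).
Proof.
move=> [mRe mIm].
rewrite (_ : (fun _ => _) = Num.sqrt \o
    (fun z => complex.Re (f z) ^+ 2 + complex.Im (f z) ^+ 2)).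
  apply: measurableT_comp.
    apply: continuous_measurable_fun; exact: sqrt_continuous.
  by apply: measurable_funD; apply: measurable_funX.
by apply/funext => z /=; rewrite /cmod; case: (f z).
Qed.

Lemma cmeasurableM f g :
  cmeasurable f -> cmeasurable g -> cmeasurable (fun z => f z * g z).
Proof.
move=> [mRf mIf] [mRg mIg]; split.
  rewrite (_ : (fun _ => _) = fun z => complex.Re (f z) * complex.Re (g z) -
      complex.Im (f z) * complex.Im (g z)).
    by apply: measurable_funB; apply: measurable_funM.
  by apply/funext => z; case: (f z); case: (g z).
rewrite (_ : (fun _ => _) = fun z => complex.Re (f z) * complex.Im (g z) +
    complex.Im (f z) * complex.Re (g z)).
  by apply: measurable_funD; apply: measurable_funM.
by apply/funext => z; case: (f z); case: (g z).
Qed.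

Lemma cmeasurable_expi (t : 'rV[R]_m -> R) :
  measurable_fun setT t -> cmeasurable (fun z => expi (t z)).
Proof.
move=> mt; split => /=.
  apply: (measurableT_comp _ mt); apply: continuous_measurable_fun.
  exact: continuous_cos.
apply: (measurableT_comp _ mt); apply: continuous_measurable_fun.
exact: continuous_sin.
Qed.

End complex_measurable.

Lemma cmeasurable_comp (R : realType) (m1 m2 : nat) (f : 'rV[R]_m2 -> R[i])
    (u : 'rV[R]_m1 -> 'rV[R]_m2) :
  cmeasurable f -> measurable_fun setT u -> cmeasurable (fun z => f (u z)).
Proof.
by move=> [mRe mIm] mu; split;
  [exact: (measurableT_comp mRe mu)|exact: (measurableT_comp mIm mu)].
Qed.

(** * Invariance of Lebesgue measure and of integrals under weighted permutations *)

Section weighted_permutation.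
Variables (R : realType) (m : nat) (s : 'S_m) (c : 'I_m -> R).

(** The action of a monomial matrix, whose determinant is the sign of [s] times [\prod_j c j]. The
    condition that this product has absolute value 1 is thus the condition of preserving volume. *)
Definition wperm_rV (z : 'rV[R]_m) : 'rV[R]_m := \row_j (c j * z ord0 (s j)).

Lemma wperm_rVE z j : wperm_rV z ord0 j = c j * z ord0 (s j).
Proof. by rewrite mxE. Qed.

Lemma measurable_wperm_rV : measurable_fun setT wperm_rV.
Proof.
apply: measurable_fun_rVP => i.
rewrite (_ : (fun _ => _) =
    ( *%R (c i) : measurableTypeR R -> measurableTypeR R) \o
    (fun z : 'rV[R]_m => z ord0 (s i) : measurableTypeR R)).
  apply: measurableT_comp; first exact: mulrl_measurable.
  exact: measurable_rV_coord.
by apply/funext => z; rewrite /= wperm_rVE.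
Qed.

Hypothesis c_neq0 : forall j, c j != 0.

(** Coordinate [i] of [z] enters only the output coordinate [s^-1 i], so each constraint on the
    output restricts a single input coordinate. *)
Lemma wperm_rV_box (A : 'I_m -> set (measurableTypeR R)) :
  wperm_rV @^-1` [set z | forall i, A i (z ord0 i)] =
  [set z | forall i, ( *%R (c ((s^-1)%g i)) @^-1` A ((s^-1)%g i)) (z ord0 i)].
Proof.
apply/seteqP; split=> z /= zA i.
  by have := zA ((s^-1)%g i); rewrite wperm_rVE permKV.
by rewrite wperm_rVE; have := zA (s i); rewrite permK.
Qed.

Lemma lebesgue_wperm_rV_box (A : 'I_m -> set (measurableTypeR R)) :
  (forall i, measurable (A i)) -> `|\prod_j c j| = 1 ->
  lebesgue_rV m (wperm_rV @^-1` [set z | forall i, A i (z ord0 i)]) =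
  lebesgue_rV m [set z | forall i, A i (z ord0 i)].
Proof.
move=> mA c1; rewrite wperm_rV_box [RHS]lebesgue_rV_box//.
rewrite (@lebesgue_rV_box _ _
  (fun i => *%R (c ((s^-1)%g i)) @^-1` A ((s^-1)%g i))); last first.
  move=> i; rewrite -[X in measurable X]setTI.
  by apply: mulrl_measurable => //; exact: mA.
under eq_bigr do rewrite lebesgue_measure_preimage_scale//.
(* Reindexing by [s] undoes the inverse permutation, after which the scaling factors collect into
   the inverse of [|\prod_j c j|]. *)
rewrite (reindex_inj (h := s)) /=; last exact: perm_inj.
under eq_bigr do rewrite permK.
rewrite big_split/= prodEFin prodfV -normr_prod c1.
by rewrite invr1 mul1e.
Qed.

(** Two measures agree once they agree on a generating family closed under intersection that
    contains a cover by sets of finite measure. Here the family is that of measurable boxes, and the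
    cover is by the cubes [g k]. *)
Lemma lebesgue_wperm_rV (A : set 'rV[R]_m) :
  `|\prod_j c j| = 1 -> measurable A ->
  lebesgue_rV m (wperm_rV @^-1` A) = lebesgue_rV m A.
Proof.
move=> c1 mA.
pose box (B : 'I_m -> set (measurableTypeR R)) :=
  [set z : 'rV[R]_m | forall i, B i (z ord0 i)].
pose G := [set box B | B in [set B | forall i, measurable (B i)]].
pose g (k : nat) := box (fun=> `[- k%:R, k%:R]%classic).
pose push := (pushforward (lebesgue_rV m) wperm_rV
  : {measure set 'rV[R]_m -> \bar R}).
apply/esym.
apply: (@measure_unique _ _ _ G g _ _ _ _ _ (push measurable_wperm_rV)) => //.
- rewrite eqEsubset; split; apply: smallest_sub.
  + exact: smallest_sigma_algebra.
  + rewrite -bigcup_seq => _ /= [i _ [B mB <-]]; apply: sub_sigma_algebra.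
    (* A condition on one coordinate is a box whose other sides are the whole line. *)
    exists (fun j => if j == i then B else setT).
      by move=> j /=; case: ifP.
    apply/seteqP; split=> z /=.
      by move=> /(_ i); rewrite eqxx.
    by move=> [_ Bz] j; case: ifPn => // /eqP ->.
  + exact: sigma_algebra_measurable.
  + by move=> _ [B mB <-]; exact: measurable_rV_box.
- move=> _ _ [B mB <-] [C mC <-]; exists (fun i => B i `&` C i).
    by move=> i; exact: measurableI.
  apply/seteqP; split=> z /=; first by move=> BC; split=> i; have [] := BC i.
  by move=> [Bz Cz] i.
- by move=> k; exists (fun=> `[- k%:R, k%:R]%classic).
(* The sum of the absolute values bounds every coordinate at once, so one integer above it gives a
   cube containing [z]. *)
- rewrite -subTset => z _; exists (Num.bound (\sum_i `|z ord0 i|)) => //= i.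
  rewrite /= in_itv/= -ler_norml (le_trans _ (ltW (archi_boundP _)))//.
    by rewrite (bigD1 i)//= lerDl sumr_ge0.
  exact: sumr_ge0.
- by move=> _ [B mB <-]; rewrite /push /= /pushforward lebesgue_wperm_rV_box.
- move=> k.
  have /= -> := @lebesgue_rV_box _ m _ (fun=> measurable_itv `[- k%:R, k%:R]).
  rewrite ltey_eq prode_fin_num// => i _.
  by rewrite lebesgue_measure_itv/=; case: ifP.
Qed.

(** Nonnegative functions are handled by the pushforward measure. The general integral is by
    definition the difference of those of the positive and negative parts, which commute with
    composition. *)
Lemma integral_wperm_rV (f : 'rV[R]_m -> \bar R) :
  `|\prod_j c j| = 1 -> measurable_fun setT f ->
  (\int[lebesgue_rV m]_z f (wperm_rV z) = \int[lebesgue_rV m]_z f z)%E.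
Proof.
move=> c1.
have ge0 (g : 'rV[R]_m -> \bar R) :
    measurable_fun setT g -> (forall z, 0 <= g z)%E ->
    (\int[lebesgue_rV m]_z g (wperm_rV z) = \int[lebesgue_rV m]_z g z)%E.
  move=> mg g0.
  transitivity (\int[pushforward (lebesgue_rV m) wperm_rV]_z g z)%E.
    by rewrite ge0_integral_pushforward//; exact: measurable_wperm_rV.
  apply: eq_measure_integral => [|mw A mA _]; first exact: measurable_wperm_rV.
  exact: lebesgue_wperm_rV.
move=> mf; rewrite integralE [RHS]integralE; congr (_ - _)%E.
- rewrite -(ge0 _ (measurable_funepos mf)); first by rewrite !unlock.
  by move=> z; exact: funepos_ge0.
- rewrite -(ge0 _ (measurable_funeneg mf)); first by rewrite !unlock.
  by move=> z; exact: funeneg_ge0.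
Qed.

Lemma cintegral_wperm_rV (f : 'rV[R]_m -> R[i]) :
  `|\prod_j c j| = 1 -> cmeasurable f ->
  cintegral (f \o wperm_rV) = cintegral f.
Proof.
move=> c1 [/measurable_EFinP mRe /measurable_EFinP mIm].
rewrite /cintegral /Rintegral -(integral_wperm_rV c1 mRe).
by rewrite -(integral_wperm_rV c1 mIm).
Qed.

Lemma inLp_wperm_rV (p : nat) (f : 'rV[R]_m -> R[i]) :
  `|\prod_j c j| = 1 -> inLp p f -> inLp p (f \o wperm_rV).
Proof.
move=> c1 [mf foo]; split.
  exact: (cmeasurable_comp mf measurable_wperm_rV).
rewrite (integral_wperm_rV (f := fun x => (cmod (f x) ^+ p)%:E) c1)//.
apply/measurable_EFinP; apply: measurable_funX; exact: measurable_cmod.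
Qed.

End weighted_permutation.

(** * Schwartz functions and tempered distributions under weighted permutations *)

Lemma cmodM (R : realType) (z w : R[i]) : cmod (z * w) = cmod z * cmod w.
Proof. exact: ComplexField.Normc.normcM. Qed.

Lemma cmod_real (R : realType) (r : R) : cmod r%:C = `|r|.
Proof. by rewrite /cmod /= expr0n addr0 sqrtr_sqr. Qed.

(** The set of values is bounded above, so its [sup] dominates the nonnegative value at 0. *)
Lemma seminorm_ge0 (R : realType) (m : nat) (f : 'rV[R]_m -> R[i]) a b :
  schwartz f -> 0 <= seminorm a b f.
Proof.
move=> [_ bf]; apply: (@le_trans _ _ (`|monomial a 0| * cmod (partials b f 0))).
  by rewrite mulr_ge0//; case: (partials b f 0) => u w; exact: sqrtr_ge0.
by apply: ub_le_sup => //; exists 0.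
Qed.

Section schwartz_wperm.
Variables (R : realType) (m : nat) (s : 'S_m) (c : 'I_m -> R).
Local Notation L := (wperm_rV s c).
Local Notation t := (s^-1)%g.

Lemma wperm_rV_is_linear : linear L.
Proof. by move=> a u w; apply/rowP => j; rewrite !mxE; ring. Qed.

Lemma wperm_rV_delta i :
  L (delta_mx ord0 i) = c (t i) *: delta_mx ord0 (t i).
Proof.
apply/rowP => j; rewrite !mxE !eqxx/=.
have [->|jti] := eqVneq j (t i); first by rewrite permKV eqxx.
rewrite (_ : s j == i = false) ?mulr0//.
by apply: contra_neqF jti => /eqP <-; rewrite permK.
Qed.

Lemma differentiable_wperm_rV x : differentiable L x.
Proof.
rewrite (_ : L = \sum_(j < m) (fun z : 'rV[R]_m =>
    (c j * z ord0 (s j)) *: (delta_mx ord0 j : 'rV[R]_m))).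
  apply: differentiable_sum => j; apply: differentiableZl.
  apply: (@differentiableZ _ _ _ (fun z : 'rV[R]_m => z ord0 (s j)) (c j)).
  exact: differentiable_coord.
apply/funext => z; rewrite fct_sumE [LHS]row_sum_delta.
by apply: eq_bigr => j _; rewrite wperm_rVE.
Qed.

(** The factor [k] is carried along so that the formula can be iterated: it absorbs the weights
    produced by the earlier derivatives. *)
Lemma derive_wperm_rV i k (g : 'rV[R]_m -> R) x : differentiable g (L x) ->
  'D_(delta_mx ord0 i) (fun z => k * g (L z)) x =
  c (t i) * k * 'D_(delta_mx ord0 (t i)) g (L x).
Proof.
move=> dg.
have -> : 'D_(delta_mx ord0 i) (fun z => k * g (L z)) x =
    'D_(L (delta_mx ord0 i)) (fun z => k * g z) (L x).
  (* By linearity of [L] the two difference quotients are the same function, so their limits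
     agree. *)
  rewrite /derive; set p := (fun _ : R => _); set q := (fun _ : R => _).
  suff -> : p = q by [].
  by apply/funext => a; rewrite /p /q /= wperm_rV_is_linear.
have dkg : differentiable (fun z => k * g z) (L x).
  exact: (@differentiableZ _ _ _ g k (L x) dg).
have diffkg : 'd (fun z => k * g z) (L x) = k \*: 'd g (L x) :> (_ -> _).
  exact: (@diffZ _ _ _ g k (L x) dg).
rewrite deriveE// diffkg wperm_rV_delta /= linearZ -deriveE//.
by rewrite [c _ * k]mulrC -mulrA.
Qed.

(** Iterated chain rule, by induction on [b]; smoothness supplies the differentiability of each
    intermediate derivative at [L x]. *)
Lemma partials_wperm_rV (f : 'rV[R]_m -> R[i]) b : smooth f ->
  partials b (f \o L) = fun x =>
    (\prod_(i <- b) c (t i))%:C * partials (map t b) f (L x).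
Proof.
move=> sf; elim: b => [|i b IH] /=.
  by apply/funext => x; rewrite big_nil mul1r.
rewrite IH; apply/funext => x; rewrite /partial big_cons.
have [dRe dIm] := sf (map t b) (L x).
set k := \prod_(_ <- b) _; set F := partials _ f.
have -> : (fun y => complex.Re (k%:C * F (L y))) =
    (fun y => k * complex.Re (F (L y))).
  by apply/funext => y; case: (F (L y)) => u w /=; ring.
have -> : (fun y => complex.Im (k%:C * F (L y))) =
    (fun y => k * complex.Im (F (L y))).
  by apply/funext => y; case: (F (L y)) => u w /=; ring.
rewrite (derive_wperm_rV i k dRe) (derive_wperm_rV i k dIm).
by apply/eqP; rewrite eq_complex /=; apply/andP; split; apply/eqP; ring.
Qed.

Lemma smooth_wperm_rV (f : 'rV[R]_m -> R[i]) : smooth f -> smooth (f \o L).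
Proof.
move=> sf b x; rewrite partials_wperm_rV//.
have [dRe dIm] := sf (map t b) (L x).
set k := \prod_(_ <- b) _; set F := partials _ f.
have -> : (fun y => complex.Re (k%:C * F (L y))) =
    k *: ((fun y => complex.Re (F y)) \o L).
  apply/funext => y; transitivity (k * complex.Re (F (L y))) => //.
  by case: (F (L y)) => u w /=; ring.
have -> : (fun y => complex.Im (k%:C * F (L y))) =
    k *: ((fun y => complex.Im (F y)) \o L).
  apply/funext => y; transitivity (k * complex.Im (F (L y))) => //.
  by case: (F (L y)) => u w /=; ring.
by split; apply: differentiableZ; apply: differentiable_comp => //;
  exact: differentiable_wperm_rV.
Qed.

Hypothesis c_neq0 : forall j, c j != 0.

Lemma monomial_wperm_rV a x :
  monomial a x = (\prod_(i <- a) (c (t i))^-1) * monomial (map t a) (L x).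
Proof.
rewrite /monomial big_map -big_split/=; apply: eq_bigr => i _.
by rewrite wperm_rVE permKV mulKf.
Qed.

(** The factor by which a seminorm term changes: the monomial contributes inverse weights, the
    derivatives contribute the weights themselves. *)
Definition wperm_weight (a b : seq 'I_m) : R :=
  `|\prod_(i <- a) (c (t i))^-1| * `|\prod_(i <- b) c (t i)|.

Lemma seminorm_term_wperm_rV (f : 'rV[R]_m -> R[i]) a b x : smooth f ->
  `|monomial a x| * cmod (partials b (f \o L) x) =
  wperm_weight a b *
  (`|monomial (map t a) (L x)| * cmod (partials (map t b) f (L x))).
Proof.
move=> sf; rewrite partials_wperm_rV// cmodM cmod_real monomial_wperm_rV normrM.
by rewrite /wperm_weight; ring.
Qed.

Lemma schwartz_wperm_rV (f : 'rV[R]_m -> R[i]) :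
  schwartz f -> schwartz (f \o L).
Proof.
move=> [sf bf]; split; first exact: smooth_wperm_rV.
move=> a b; have [M Mf] := bf (map t a) (map t b).
exists (wperm_weight a b * M) => _ [x _ <-].
rewrite seminorm_term_wperm_rV// ler_wpM2l ?mulr_ge0//.
by apply: Mf; exists (L x).
Qed.

Lemma seminorm_wperm_rV (f : 'rV[R]_m -> R[i]) a b : schwartz f ->
  seminorm a b (f \o L) <= wperm_weight a b * seminorm (map t a) (map t b) f.
Proof.
move=> [sf bf]; apply: ge_sup.
  by exists (`|monomial a 0| * cmod (partials b (f \o L) 0)), 0.
move=> _ [x _ <-].
rewrite seminorm_term_wperm_rV// ler_wpM2l ?mulr_ge0//.
by apply: ub_le_sup => //; exists (L x).
Qed.

(** Composition with [L] carries the seminorm indices [(a, b)] to [(map t a, map t b)], so the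
    continuity bound of [u] survives with a relabelled list and a larger constant. *)
Lemma tempered_wperm_rV (u : @functional R m) :
  tempered u -> tempered (fun f => u (f \o L)).
Proof.
move=> [ulin [C [l ub]]]; split.
  move=> k f g sf sg; rewrite -(ulin k (f \o L) (g \o L))//.
    exact: schwartz_wperm_rV.
  exact: schwartz_wperm_rV.
(* The weights are nonnegative, so their sum bounds each of them. The constant uses [|C|] because
   [C] may be negative. *)
pose K := \sum_(ab <- l) wperm_weight ab.1 ab.2.
exists (`|C| * K), [seq (map t ab.1, map t ab.2) | ab <- l] => f sf.
apply: (le_trans (ub _ (schwartz_wperm_rV sf))).
apply: (@le_trans _ _ (`|C| * \sum_(ab <- l) seminorm ab.1 ab.2 (f \o L))).
  apply: ler_wpM2r; last exact: ler_norm.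
  by apply: sumr_ge0 => ab _; apply: seminorm_ge0; exact: schwartz_wperm_rV.
rewrite -mulrA ler_wpM2l// big_map /= mulr_sumr !big_seq ler_sum// => ab abl.
apply: (le_trans (seminorm_wperm_rV _ _ sf)).
apply: ler_wpM2r; first exact: seminorm_ge0.
rewrite /K (big_rem ab)//= lerDl sumr_ge0// => ? _.
by rewrite mulr_ge0.
Qed.

End schwartz_wperm.

(** * Measurability of vector operations *)

Section measurable_rV_operations.
Variables (R : realType) (d : measure_display) (T : measurableType d).

Lemma measurable_rV_coordT m (u : T -> 'rV[R]_m) i :
  measurable_fun setT u -> measurable_fun setT (fun z => u z ord0 i).
Proof. by move=> mu; exact: (measurableT_comp (measurable_rV_coord i) mu). Qed.

Lemma measurable_rVD m (u w : T -> 'rV[R]_m) :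
  measurable_fun setT u -> measurable_fun setT w ->
  measurable_fun setT (fun z => u z + w z).
Proof.
move=> mu mw; apply: measurable_fun_rVP => i.
rewrite (_ : (fun _ => _) = (fun z => u z ord0 i) \+ (fun z => w z ord0 i)).
  by apply: measurable_funD; exact: measurable_rV_coordT.
by apply/funext => z; rewrite mxE.
Qed.

Lemma measurable_rVB m (u w : T -> 'rV[R]_m) :
  measurable_fun setT u -> measurable_fun setT w ->
  measurable_fun setT (fun z => u z - w z).
Proof.
move=> mu mw; apply: measurable_fun_rVP => i.
rewrite (_ : (fun _ => _) = (fun z => u z ord0 i) \- (fun z => w z ord0 i)).
  by apply: measurable_funB; exact: measurable_rV_coordT.
by apply/funext => z; rewrite !mxE.
Qed.

Lemma measurable_row_mx m1 m2 (u : T -> 'rV[R]_m1) (w : T -> 'rV[R]_m2) :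
  measurable_fun setT u -> measurable_fun setT w ->
  measurable_fun setT (fun z => row_mx (u z) (w z)).
Proof.
move=> mu mw; apply: measurable_fun_rVP => i; case: (split_ordP i) => j ->.
  rewrite (_ : (fun _ => _) = fun z => u z ord0 j).
    exact: measurable_rV_coordT.
  by apply/funext => z; rewrite row_mxEl.
rewrite (_ : (fun _ => _) = fun z => w z ord0 j).
  exact: measurable_rV_coordT.
by apply/funext => z; rewrite row_mxEr.
Qed.

Lemma measurable_lsubmx m1 m2 (u : T -> 'rV[R]_(m1 + m2)) :
  measurable_fun setT u -> measurable_fun setT (fun z => lsubmx (u z)).
Proof.
move=> mu; apply: measurable_fun_rVP => i.
rewrite (_ : (fun _ => _) = fun z => u z ord0 (lshift m2 i)).
  exact: measurable_rV_coordT.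
by apply/funext => z; rewrite mxE.
Qed.

Lemma measurable_rsubmx m1 m2 (u : T -> 'rV[R]_(m1 + m2)) :
  measurable_fun setT u -> measurable_fun setT (fun z => rsubmx (u z)).
Proof.
move=> mu; apply: measurable_fun_rVP => i.
rewrite (_ : (fun _ => _) = fun z => u z ord0 (rshift m1 i)).
  exact: measurable_rV_coordT.
by apply/funext => z; rewrite mxE.
Qed.

Lemma measurable_dot m (u w : T -> 'rV[R]_m) :
  measurable_fun setT u -> measurable_fun setT w ->
  measurable_fun setT (fun z => dot (u z) (w z)).
Proof.
move=> mu mw; apply: measurable_sum => i.
by apply: measurable_funM; exact: measurable_rV_coordT.
Qed.

(** The common shape of the exponents in [Lambda] and [Rho], with [a] equal to [pi * h] and [b] to
    [2 * s] or [- 2 * s]. *)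
Lemma measurable_phase m (a b : R) (x y x' y' : T -> 'rV[R]_m) :
  measurable_fun setT x -> measurable_fun setT y ->
  measurable_fun setT x' -> measurable_fun setT y' ->
  measurable_fun setT (fun z => a * (b + dot (x z) (y' z) - dot (y z) (x' z))).
Proof.
move=> mx my mx' my'; apply: measurable_funM => //.
apply: measurable_funB; last exact: measurable_dot.
by apply: measurable_funD => //; exact: measurable_dot.
Qed.

End measurable_rV_operations.

(** * The operators under the integral signs *)

Section lambda_rho.
Variables (R : realType) (n : nat) (h : R).
Implicit Types (f : 'rV[R]_(n + n) -> R[i]).

Lemma cmeasurable_LambdaR f p :
  cmeasurable f -> cmeasurable (fun z => LambdaR h z f p).
Proof.
move=> mf; rewrite /LambdaR /Lambda /Rho.
have mid : measurable_fun setT (fun z : 'rV[R]_(n + n + (n + n)) => z).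
  exact: measurable_id.
have m1 : measurable_fun setT (@blk1 R n) by do 2 apply: measurable_lsubmx.
have m2 : measurable_fun setT (@blk2 R n).
  by apply: measurable_rsubmx; exact: measurable_lsubmx.
have m3 : measurable_fun setT (@blk3 R n).
  by apply: measurable_lsubmx; exact: measurable_rsubmx.
have m4 : measurable_fun setT (@blk4 R n) by do 2 apply: measurable_rsubmx.
(* [Rho] is evaluated at the point already shifted by [Lambda], so the phase of [Rho] depends on [z]
   through this vector as well. *)
have mrow : measurable_fun setT (fun z : 'rV[R]_(n + n + (n + n)) =>
    row_mx (lsubmx p - blk1 z) (rsubmx p - blk2 z)).
  by apply: measurable_row_mx; apply: measurable_rVB.
have ml := measurable_lsubmx mrow.
have mr := measurable_rsubmx mrow.
apply: cmeasurableM.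
  by apply: cmeasurable_expi; apply: measurable_phase.
apply: cmeasurableM.
  by apply: cmeasurable_expi; apply: measurable_phase.
apply: (cmeasurable_comp mf).
by apply: measurable_row_mx; apply: measurable_rVD.
Qed.

(** [Bmap v] puts the blocks in the order and scale in which [LambdaR] reads them. The theorem
    thereby reduces to a change of variables. *)
Lemma Xi0_LambdaR v z f : Xi0 h v z f = LambdaR h (Bmap v z) f.
Proof.
by rewrite /LambdaR /blk1 /blk2 /blk3 /blk4 /Bmap !(row_mxKl, row_mxKr).
Qed.

End lambda_rho.

(** * [Bmap v] as a weighted permutation of order 3 *)

Section Bmap_weighted_permutation.
Variables (R : realType) (n : nat) (v : R).
Hypothesis v_neq0 : v != 0.

(** A 3-cycle of blocks: blocks 1, 2, 3, 4 of the image come from blocks 1, 3, 4, 2 of the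
    argument. *)
Definition Bmap_index (j : 'I_(n + n + (n + n))) : 'I_(n + n + (n + n)) :=
  match fintype.split j with
  | inl k => match fintype.split k with
             | inl i => lshift _ (lshift _ i)
             | inr i => rshift _ (lshift _ i)
             end
  | inr k => match fintype.split k with
             | inl i => rshift _ (rshift _ i)
             | inr i => lshift _ (rshift _ i)
             end
  end.

Definition Bmap_coef (j : 'I_(n + n + (n + n))) : R :=
  match fintype.split j with
  | inl k => 1
  | inr k => if fintype.split k is inl _ then v else v^-1
  end.

Lemma split_lshift m1 m2 (i : 'I_m1) : fintype.split (lshift m2 i) = inl i.
Proof. exact: (unsplitK (inl i)). Qed.

Lemma split_rshift m1 m2 (i : 'I_m2) : fintype.split (rshift m1 i) = inr i.
Proof. exact: (unsplitK (inr i)). Qed.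

Let splitE := (split_lshift, split_rshift).

(** The square of a 3-cycle is its inverse; this yields the injectivity that [perm] requires. *)
Lemma Bmap_indexK : cancel Bmap_index (Bmap_index \o Bmap_index).
Proof.
move=> j; rewrite /Bmap_index /=.
by case: (split_ordP j) => k ->; case: (split_ordP k) => i ->;
  do 4 rewrite ?splitE /=.
Qed.

Definition Bmap_perm : 'S_(n + n + (n + n)) := perm (can_inj Bmap_indexK).

Lemma BmapE : Bmap v = wperm_rV Bmap_perm Bmap_coef.
Proof.
apply/funext => z; apply/rowP => j.
rewrite wperm_rVE permE /Bmap_index /Bmap_coef /Bmap /blk1 /blk2 /blk3 /blk4.
by case: (split_ordP j) => k ->; case: (split_ordP k) => i ->;
  do 2 rewrite ?splitE /=; rewrite !(row_mxEl, row_mxEr, mxE) ?mul1r.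
Qed.

Lemma Bmap_coef_neq0 j : Bmap_coef j != 0.
Proof.
rewrite /Bmap_coef; case: fintype.split => [_|k]; first exact: oner_neq0.
by case: fintype.split => _; rewrite ?invr_eq0.
Qed.

(** The [n] weights [v] of the third block cancel against the [n] weights [v^-1] of the fourth. *)
Lemma prod_Bmap_coef : \prod_j Bmap_coef j = 1.
Proof.
rewrite big_split_ord /= [X in X * _]big1 ?mul1r => [|k _]; last first.
  by rewrite /Bmap_coef splitE.
rewrite big_split_ord /= -big_split big1 //= => i _.
by rewrite /Bmap_coef !splitE divff.
Qed.

(** In three rounds each of the three moving blocks is multiplied once by [v] and once by [v^-1]. *)
Lemma Bmap_cube (z : 'rV[R]_(n + n + (n + n))) : Bmap v (Bmap v (Bmap v z)) = z.
Proof.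
rewrite /Bmap /blk1 /blk2 /blk3 /blk4 !(row_mxKl, row_mxKr).
by rewrite !scalerA mulVf ?divff// !scale1r !hsubmxK.
Qed.

Fact Bmap_is_linear : linear (@Bmap R n v).
Proof. rewrite BmapE; exact: wperm_rV_is_linear. Qed.

(** [lin1_mx] records only the values on basis vectors, so linearity is packed with [Bmap v]
    here. *)
Lemma mul_lin1_Bmap (z : 'rV[R]_(n + n + (n + n))) :
  z *m lin1_mx (@Bmap R n v) = Bmap v z.
Proof.
exact: (mul_rV_lin1 (HB.pack (@Bmap R n v)
  (GRing.isLinear.Build R _ _ _ _ Bmap_is_linear) : {linear _ -> _})).
Qed.

Lemma lin1_Bmap_cube :
  lin1_mx (@Bmap R n v) *m lin1_mx (Bmap v) *m lin1_mx (Bmap v) = 1%:M.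
Proof.
apply/row_matrixP => i; rewrite !rowE !mulmxA !mul_lin1_Bmap Bmap_cube.
by rewrite mulmx1.
Qed.

Lemma det_lin1_Bmap : \det (lin1_mx (@Bmap R n v)) = 1.
Proof.
have := congr1 determinant lin1_Bmap_cube.
rewrite !det_mulmx det1; set x := \det _ => x3.
(* This is [x ^+ 3 - 1] factored with the square completed; the second factor is positive, so 1 is
   the only real cube root of 1. *)
have : (x - 1) * ((x + 2^-1) ^+ 2 + 3 / 4) = 0.
  have -> : (x - 1) * ((x + 2^-1) ^+ 2 + 3 / 4) = x * x * x - 1 by field.
  by rewrite x3 subrr.
move/eqP; rewrite mulf_eq0 subr_eq0 => /orP[/eqP//|].
by rewrite gt_eqF// ltr_wpDl ?sqr_ge0.
Qed.

Lemma mul_invmx_Bmap (z : 'rV[R]_(n + n + (n + n))) :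
  z *m invmx (lin1_mx (@Bmap R n v)) = Bmap v (Bmap v z).
Proof.
have M3 := lin1_Bmap_cube; have [_ Mu] := mulmx1_unit M3.
(* Writing [z] as its third iterate exposes one factor of the matrix, which cancels the inverse and
   leaves the second iterate. *)
by rewrite -{1}[z]Bmap_cube -mul_lin1_Bmap mulmxK.
Qed.

Lemma dist_comp_Bmap (u : @functional R (n + n + (n + n))) :
  dist_comp u (Bmap v) = fun f => u (f \o Bmap v \o Bmap v).
Proof.
apply/funext => f; rewrite /dist_comp det_lin1_Bmap normr1 invr1 mul1r.
by congr u; apply/funext => z; rewrite /= mul_invmx_Bmap.
Qed.

Lemma tempered_Bmap (u : @functional R (n + n + (n + n))) :
  tempered u -> tempered (dist_comp u (Bmap v)).
Proof.
move=> tu; rewrite dist_comp_Bmap BmapE.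
have tempered_comp := tempered_wperm_rV Bmap_perm Bmap_coef_neq0.
exact: tempered_comp (tempered_comp _ tu).
Qed.

End Bmap_weighted_permutation.

(** * Change of variables for integrable kernels and for tempered distributions *)

Theorem lemma6p6 (R : realType) (n : nat) (h v : R) (h_neq0 : h != 0)
    (v_neq0 : v != 0) :
  (forall k : 'rV[R]_(n + n + (n + n)) -> R[i],
     inLp 1 k ->
     inLp 1 (k \o Bmap v) /\
     forall f : 'rV[R]_(n + n) -> R[i], inLp 2 f ->
       {ae lebesgue_rV (n + n), forall p,
         Dconv h k f p = Xi_int h v (k \o Bmap v) f p}) /\
  (forall k : @functional R (n + n + (n + n)),
     tempered k ->
     tempered (dist_comp k (Bmap v)) /\
     forall f g : 'rV[R]_(n + n) -> R[i], schwartz f -> schwartz g ->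
       Dconv_weak h k f g = Xi_int_weak h v (dist_comp k (Bmap v)) f g).
Proof.
have c_neq0 := @Bmap_coef_neq0 R n v v_neq0.
have c1 : `|\prod_j @Bmap_coef R n v j| = 1.
  by rewrite prod_Bmap_coef// normr1.
split=> k.
  move=> Lk; split; first by rewrite BmapE; exact: inLp_wperm_rV.
  (* The two sides agree at every [p], since [cintegral_wperm_rV] applies to any measurable
     integrand. *)
  move=> f [mf _]; apply: aeW => p.
  have mkf : cmeasurable (fun z => k z * LambdaR h z f p).
    by apply: cmeasurableM; [exact: Lk.1|exact: cmeasurable_LambdaR].
  rewrite /Dconv /integrated -(cintegral_wperm_rV (Bmap_perm n) c_neq0 c1 mkf).
  by rewrite -BmapE; congr cintegral; apply/funext => z /=; rewrite Xi0_LambdaR.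
move=> tk; split; first exact: tempered_Bmap.
move=> f g _ _.
rewrite /Dconv_weak /Xi_int_weak /weakly_integrated (dist_comp_Bmap v_neq0).
(* The distribution [dist_comp k (Bmap v)] composes the test function with [Bmap v] twice and
   [Xi0_LambdaR] adds a third copy; the cube is the identity. *)
apply: (@congr1 _ _ k); apply/funext => z.
by rewrite /comp Xi0_LambdaR (Bmap_cube v_neq0).
Qed.
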